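(* Let $A$ be a basic PID and let $B$ be a ring of class (G) over $A$. Then there exists a constant $C\in\mathbb{N}$ such that for any nonzero ideal $I$ of $B$ there exists a nonzero element $\alpha\in I$ with $$N_B(\alpha)\leq C\cdot N_B(I).$$ Hence the ideal class group of $B$ is finite.
   Context: All rings are commutative with identity; $\mathbb{N}$ denotes the positive integers. A ring $R$ is called a finite quotient domain (or is said to have finite quotients) if $R$ is an integral domain and $R/I$ is finite for every nonzero ideal $I$ of $R$. For such $R$ (or more generally whenever the quotients in question are finite), a nonzero ideal $I$ and a nonzero $x\in R$, put $N_R(I)=|R/I|$, $N_R(x)=|R/xR|$, and $N_R(0)=0$. The function $N_R:R\to\mathbb{N}\cup\{0\}$ is called the ideal norm on $R$. A PID $A$ is called a basic PID if it is not a field and: (1) $A$ is a finite quotient domain; (2) there exists a constant $c\in\mathbb{N}$ such that for each $m\in\mathbb{N}$, $\#\{x\in A\mid N_A(x)\leq c\cdot m\}\geq m$ (this set being allowed to be infinite); (3) there exists a constant $C\in\mathbb{N}$ such that for all $x,y\in A$, $N_A(x+y)\leq C\cdot(N_A(x)+N_A(y))$. Let $A$ be a basic PID. A Dedekind domain $B$ is called a ring of class (G) over $A$ if $B$ is an $A$-algebra that is finitely generated and free as an $A$-module. ($A$ is regarded as a subring of $B$ via $a\mapsto a\cdot 1$. Such a $B$ is again a finite quotient domain, so that $N_B$ is defined.) The ideal class group of a Dedekind domain $R$ is the group of equivalence classes of nonzero ideals of $R$, where $I\sim J$ if $aI=bJ$ for some nonzero $a,b\in R$, with group operation induced by multiplication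 of ideals. *)

(* Defs.v *)
From mathcomp Require Export all_boot all_order all_algebra finmap.
From mathcomp Require Export boolp classical_sets functions cardinality.

Set Implicit Arguments.
Unset Strict Implicit.
Unset Printing Implicit Defensive.

Export Order.TTheory GRing.Theory.

Open Scope classical_set_scope.
Open Scope ring_scope.

Section Ideals.

Variable R : comNzRingType.
Implicit Types (I J P : set R) (a x y : R).

(* Unlike the idealr predicates of MathComp's ring_quotient, the whole ring
   counts as an ideal. *)
Definition is_ideal I : Prop :=
  [/\ I 0, forall x y, I x -> I y -> I (x + y) & forall a x, I x -> I (a * x)].

Definition nonzero_ideal I : Prop := is_ideal I /\ I <> [set 0].

Definition principal_ideal x : set R := range (fun a => a * x).

Definition scale_ideal a I : set R := [set a * x | x in I].

Definition prime_ideal P : Prop :=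
  [/\ is_ideal P, P <> setT & forall x y, P (x * y) -> P x \/ P y].

Definition maximal_ideal P : Prop :=
  [/\ is_ideal P, P <> setT
    & forall J, is_ideal J -> P `<=` J -> J = P \/ J = setT].

Definition ideal_quotient I : set (set R) :=
  range (fun x => [set y | I (y - x)]).

Definition finite_quotients : Prop :=
  forall I, nonzero_ideal I -> finite_set (ideal_quotient I).

(* fset_set sends infinite sets to fset0, so this is the index of I when
   R / I is finite, and 0 otherwise. *)
Definition ideal_norm I : nat := #|` fset_set (ideal_quotient I)|%fset.

Definition norm x : nat := if x == 0 then 0%N else ideal_norm (principal_ideal x).

Definition noetherian : Prop :=
  forall I, is_ideal I -> exists n (g : 'I_n -> R),
    I = [set \sum_(i < n) c i * g i | c in [set: 'I_n -> R]].

End Ideals.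

Arguments finite_quotients R : clear implicits.
Arguments noetherian R : clear implicits.

Definition integrally_closed (R : idomainType) : Prop :=
  forall z : {fraction R}, integralOver (@tofrac R) z -> exists x : R, z = tofrac x.

(* Under this convention fields are Dedekind domains. *)
Definition dedekind_domain (R : idomainType) : Prop :=
  [/\ noetherian R, integrally_closed R
    & forall P : set R, prime_ideal P -> P <> [set 0] -> maximal_ideal P].

Definition principal_ideal_domain (R : idomainType) : Prop :=
  forall I : set R, is_ideal I -> exists x, I = principal_ideal x.

Definition basic_PID (A : idomainType) : Prop :=
  [/\ principal_ideal_domain A,
      exists x : A, x != 0 /\ x \isn't a GRing.unit,
      finite_quotients A,
      exists c : nat, (0 < c)%N /\
        forall m : nat, (0 < m)%N ->
          (`I_m #<= [set x : A | (norm x <= c * m)%N])%card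
    & exists C : nat, (0 < C)%N /\
        forall x y : A, (norm (x + y) <= C * (norm x + norm y))%N].

(* The A-module structure on B is a . b = phi a * b. *)
Definition finite_free (A B : idomainType) (phi : {rmorphism A -> B}) : Prop :=
  exists n (e : 'I_n -> B),
    forall b : B, exists! c : 'rV[A]_n, b = \sum_(i < n) phi (c 0 i) * e i.

Definition class_G (A B : idomainType) (phi : {rmorphism A -> B}) : Prop :=
  dedekind_domain B /\ finite_free phi.

Section ClassGroup.

Variable R : idomainType.

Definition ideal_equiv (I J : set R) : Prop :=
  exists a b : R, [/\ a != 0, b != 0 & scale_ideal a I = scale_ideal b J].

(* The underlying set of the group: its elements are the equivalence classes,
   each a set of nonzero ideals. *)
Definition ideal_class_group : set (set (set R)) :=
  [set [set J | nonzero_ideal J /\ ideal_equiv I J]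
     | I in [set I : set R | nonzero_ideal I]].

End ClassGroup.

Arguments ideal_class_group R : clear implicits.

(* Main.v *)
Require Import Defs.
From mathcomp Require Import perm ring.

(** The argument is Minkowski's, with the size function of A in place of an
    absolute value and the pigeonhole principle in place of convex bodies.

    Fix a basis of B over A and identify B with A^n by taking linear
    combinations ([lincomb]).  The proof of the bound on elements of ideals
    combines two estimates.

    Few residues: multiplication by alpha is given in the basis by a matrix M
    over A, so that B / alpha B is A^n modulo the row lattice of M, a lattice of
    index N_A(det M) ([row_lattice_covering]).  The determinant is a polynomial,
    homogeneous of degree n in the coordinates of alpha, and N_A is
    multiplicative ([normM]) and subadditive up to a constant; hence
    N_B(alpha) <= K X^n whenever all coordinates have norm at most X
    ([norm_lincomb_leq]).

    Many small elements: if m^n > N_B(I) and A has m elements of norm at most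
    c m, then two of the m^n vectors with coordinates among these are congruent
    modulo I.  Their difference is a nonzero element alpha of I whose
    coordinates have norm O(m); so N_B(alpha) is O(m^n), which is O(N_B(I)) when
    m is chosen minimal ([small_element_of_ideal]).

    For the class group, let alpha in I satisfy N(alpha) <= C N(I).  Then
    I / alpha B has at most C elements, so among any C + 1 elements of B two
    agree in their action on a given element of I / alpha B.  Therefore the
    product b of the pairwise differences of C + 1 fixed distinct elements of B,
    which is independent of I, satisfies b I <= alpha B.  The ideal
    J = alpha^-1 b I is then equivalent to I and contains b, because alpha is in
    I; and as B / b B is finite, only finitely many ideals contain b
    ([finite_ideal_class_group]).

    Indices are compared through finite families meeting every coset
    ([covering]) and finite families of pairwise incongruent elements
    ([packing]), a packing never being larger than a covering. *)

Set Implicit Arguments.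
Unset Strict Implicit.
Unset Printing Implicit Defensive.

(** * Coverings and packings modulo a subgroup *)

Definition covering (V : zmodType) (L : set V) (T : finType) (r : T -> V) :=
  forall x, exists i, L (x - r i).

Definition packing (V : zmodType) (L : set V) (T : finType) (r : T -> V) :=
  forall i j, L (r i - r j) -> i = j.

(** * Ideals and their indices *)

Section Ideals.

Variable R : comNzRingType.
Implicit Types (I : set R) (x y : R).

Lemma ideal_opp I x : is_ideal I -> I x -> I (- x).
Proof. by case=> _ _ IM Ix; rewrite -mulN1r; apply: IM. Qed.

Lemma ideal_sub I x y : is_ideal I -> I x -> I y -> I (x - y).
Proof.
by move=> idI Ix Iy; have [_ ID _] := idI; apply: ID => //; apply: ideal_opp.
Qed.

Lemma ideal_subC I x y : is_ideal I -> I (x - y) -> I (y - x).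
Proof. by move=> idI Ixy; rewrite -opprB; apply: ideal_opp. Qed.

Lemma principal_idealP x : is_ideal (principal_ideal x).
Proof.
split; first by exists 0; rewrite ?mul0r.
- by move=> _ _ [a _ <-] [b _ <-]; exists (a + b); rewrite ?mulrDl.
- by move=> a _ [b _ <-]; exists (a * b); rewrite ?mulrA.
Qed.

Lemma principal_ideal_id x : principal_ideal x x.
Proof. by exists 1; rewrite ?mul1r. Qed.

Lemma nonzero_principal_ideal x : x != 0 -> nonzero_ideal (principal_ideal x).
Proof.
move=> x0; split; first exact: principal_idealP.
move=> E; have : [set 0] x by rewrite -E; apply: principal_ideal_id.
by move=> /= /eqP; rewrite (negbTE x0).
Qed.

(** Pigeonhole principle: two members of the packing congruent to the same
    member of the covering would be congruent to each other. *)
Lemma packing_covering_leq I (T1 T2 : finType) (p : T1 -> R) (q : T2 -> R) :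
  is_ideal I -> packing I p -> covering I q -> (#|T1| <= #|T2|)%N.
Proof.
move=> idI pp cq; have [f fP] := choice (fun i => cq (p i)).
apply: (leq_card f) => i j ij; apply: pp.
have -> : p i - p j = (p i - q (f i)) - (p j - q (f j)) by rewrite ij; ring.
exact: ideal_sub.
Qed.

Lemma not_packingP I (T : finType) (r : T -> R) :
  ~ packing I r -> exists i j, i <> j /\ I (r i - r j).
Proof.
move=> /existsNP[i /existsNP[j /not_implyP[Iij ij]]]; by exists i, j.
Qed.

Lemma coset_eqP I x y : is_ideal I ->
  [set z | I (z - x)] = [set z | I (z - y)] <-> I (x - y).
Proof.
move=> idI; split=> [E|Ixy].
  have : [set z | I (z - x)] x by rewrite /= subrr; case: idI.
  by rewrite E.
have [_ ID _] := idI; apply/seteqP; split=> z /= Iz.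
  by rewrite -(subrKA x); apply: ID.
by rewrite -(subrKA y); apply: ID => //; apply: ideal_subC.
Qed.

Lemma covering_finite I (T : finType) (r : T -> R) :
  is_ideal I -> covering I r -> finite_set (ideal_quotient I).
Proof.
move=> idI cr.
apply: (@sub_finite_set _ _ (range (fun i => [set y | I (y - r i)]))).
  by move=> _ [x _ <-]; have [i /coset_eqP->] := cr x; [exists i|].
exact/finite_image/finite_finset.
Qed.

(** The bridge from the cardinal of the set of cosets, in terms of which the
    ideal norm is defined, to coverings and packings: a system of
    representatives is both at once. *)
Lemma transversal_exists I : is_ideal I -> finite_set (ideal_quotient I) ->
  exists r : 'I_(ideal_norm I) -> R, covering I r /\ packing I r.
Proof.
move=> idI finQ; pose s := enum_fset (fset_set (ideal_quotient I)).
have sP C : C \in s = (C \in ideal_quotient I) by rewrite -in_fset_set.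
have /choice[r rP] (i : 'I_(ideal_norm I)) :
    exists x, [set y | I (y - x)] = nth set0 s i.
  have /set_mem[x _ <-] : nth set0 s i \in ideal_quotient I.
    by rewrite -sP mem_nth.
  by exists x.
exists r; split=> [x | i j /(coset_eqP _ _ idI)].
  pose Cx := [set y | I (y - x)]; have xs : Cx \in s.
    by rewrite sP; apply/mem_set; exists x.
  have xlt : (index Cx s < ideal_norm I)%N by rewrite index_mem.
  exists (Ordinal xlt); apply/(coset_eqP _ _ idI).
  by rewrite rP /= nth_index.
rewrite !rP => /eqP; rewrite nth_uniq ?fset_uniq ?ltn_ord //.
by move/eqP/val_inj.
Qed.

Lemma packing_leq I (T : finType) (r : T -> R) :
  is_ideal I -> finite_set (ideal_quotient I) -> packing I r ->
  (#|T| <= ideal_norm I)%N.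
Proof.
move=> idI /(transversal_exists idI)[q [cq _]] pr.
by rewrite -[ideal_norm I]card_ord; apply: packing_covering_leq pr cq.
Qed.

Lemma covering_geq I (T : finType) (r : T -> R) :
  is_ideal I -> covering I r -> (ideal_norm I <= #|T|)%N.
Proof.
move=> idI cr; have finI := covering_finite idI cr.
have [q [_ pq]] := transversal_exists idI finI.
by rewrite -[ideal_norm I]card_ord; apply: packing_covering_leq pq cr.
Qed.

Lemma ideal_norm_gt0 I :
  is_ideal I -> finite_set (ideal_quotient I) -> (0 < ideal_norm I)%N.
Proof.
move=> idI /(transversal_exists idI)[r [cr _]].
by have [i _] := cr 0; apply: leq_ltn_trans (ltn_ord i).
Qed.

(** An ideal containing b is a union of cosets of the ideal generated by b. *)
Lemma finite_ideals_containing b :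
  finite_set (ideal_quotient (principal_ideal b)) ->
  finite_set [set J : set R | is_ideal J /\ J b].
Proof.
move=> /(transversal_exists (principal_idealP b))[r [cr _]].
pose span (S : {set 'I_(ideal_norm (principal_ideal b))}) : set R :=
  [set x | exists2 i, i \in S & principal_ideal b (x - r i)].
apply: (@sub_finite_set _ _ (range span)); last first.
  exact/finite_image/finite_finset.
move=> J [idJ Jb]; have [_ JD JM] := idJ.
have bJ y : principal_ideal b y -> J y by case=> a _ <-; apply: JM.
exists (finset (fun i => `[< J (r i) >])) => //; apply/seteqP; split=> x /=.
  case=> i; rewrite inE => /asboolP Ji /bJ Jx.
  by rewrite -(subrK (r i) x); apply: JD.
move=> Jx; have [i bi] := cr x; exists i => //.
rewrite inE; apply/asboolP; rewrite -[r i](subKr x).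
by apply: ideal_sub (bJ _ bi).
Qed.

Lemma finite_quotients_of_principal :
  (forall b : R, b != 0 -> finite_set (ideal_quotient (principal_ideal b))) ->
  finite_quotients R.
Proof.
move=> finb I [idI I0]; have [_ _ IM] := idI.
have [b Ib b0] : exists2 b, I b & b != 0.
  apply: contrapT => noI; apply: I0; apply/seteqP.
  split=> [b Ib|_ ->]; last by case: idI.
  by apply/eqP; apply: contrapT => /negP b0; apply: noI; exists b.
have [r [cr _]] := transversal_exists (principal_idealP b) (finb b b0).
apply: (covering_finite (r := r)) => // y.
by have [i [a _ ay]] := cr y; exists i; rewrite -ay; apply: IM.
Qed.

End Ideals.

(** * The ideal norm on a finite quotient domain *)

Section Norm.

Variable A : idomainType.
Implicit Types x y : A.

Lemma norm0 : norm (0 : A) = 0%N.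
Proof. by rewrite /norm eqxx. Qed.

Lemma normE x : x != 0 -> norm x = ideal_norm (principal_ideal x).
Proof. by rewrite /norm => /negbTE->. Qed.

Lemma norm_mul_unit u x : u \is a GRing.unit -> norm (u * x) = norm x.
Proof.
move=> uu; have [->|x0] := eqVneq x 0; first by rewrite mulr0.
have u0 : u != 0 by apply: contraTneq uu => ->; rewrite unitr0.
rewrite !normE ?mulf_neq0 //; congr ideal_norm; apply/seteqP.
split=> _ [a _ <-]; first by exists (a * u); rewrite ?mulrA.
by exists (a / u); rewrite // mulrA divrK.
Qed.

Lemma norm_opp x : norm (- x) = norm x.
Proof. by rewrite -mulN1r norm_mul_unit // unitrN1. Qed.

Hypothesis finA : finite_quotients A.

Let finite_principal x :
  x != 0 -> finite_set (ideal_quotient (principal_ideal x)).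
Proof. by move/nonzero_principal_ideal/finA. Qed.

Lemma norm_gt0 x : x != 0 -> (0 < norm x)%N.
Proof.
move=> x0; rewrite normE //.
by apply: ideal_norm_gt0 (principal_idealP x) (finite_principal x0).
Qed.

(** If r represents the classes modulo x and s those modulo y, then the
    elements r i + x * s j represent the classes modulo x * y. *)
Lemma normM x y : norm (x * y) = (norm x * norm y)%N.
Proof.
have [->|x0] := eqVneq x 0; first by rewrite mul0r norm0.
have [->|y0] := eqVneq y 0; first by rewrite mulr0 norm0 muln0.
have xy0 : x * y != 0 by rewrite mulf_neq0.
rewrite !normE //.
have [r [cr pr]] :=
  transversal_exists (principal_idealP x) (finite_principal x0).
have [s [cs ps]] :=
  transversal_exists (principal_idealP y) (finite_principal y0).
pose rs (ij : 'I_(ideal_norm (principal_ideal x)) *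
              'I_(ideal_norm (principal_ideal y))) := r ij.1 + x * s ij.2.
have idxy := principal_idealP (x * y).
have card_rs := card_prod 'I_(ideal_norm (principal_ideal x))
                          'I_(ideal_norm (principal_ideal y)).
rewrite !card_ord in card_rs; rewrite -card_rs.
apply/eqP; rewrite eqn_leq; apply/andP; split.
  apply: (@covering_geq _ _ _ rs idxy) => z.
  have [i [a _ ai]] := cr z; have [j [b _ bj]] := cs a.
  exists (i, j), b => //; rewrite /rs /= opprD addrA -ai.
  by rewrite mulrCA bj; ring.
apply: (@packing_leq _ _ _ rs idxy (finite_principal xy0)).
move=> [i j] [i' j'] [b _]; rewrite /rs /= => E.
have ii' : i = i'.
  apply: pr; exists (b * y + s j' - s j) => //.
  by transitivity (b * (x * y) + x * s j' - x * s j); [ring | rewrite E; ring].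
rewrite -{i'}ii' in E *; congr pair; apply: ps; exists b => //.
apply: (mulfI x0); transitivity (b * (x * y)); first by ring.
by rewrite E; ring.
Qed.

End Norm.

(** * Row lattices over a principal ideal domain *)

Section PrincipalIdealDomain.

Variable A : idomainType.
Hypothesis pidA : principal_ideal_domain A.

(** The coefficients satisfy s * a' + t * b' = 1 even when a = b = 0, so the
    matrix with rows (s, t) and (- b', a') is always invertible; it sends the
    column (a, b) to (g, 0). *)
Lemma pid_bezout (a b : A) :
  exists g a' b' s t, [/\ a = a' * g, b = b' * g & s * a' + t * b' = 1].
Proof.
have [->|a0] := eqVneq a 0.
  by exists b, 0, 1, 0, 1; rewrite mul0r mul1r mulr0 mulr1 add0r.
pose I : set A := [set x | exists s t, x = s * a + t * b].
have [g Ig] : exists g, I = principal_ideal g.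
  apply: pidA; split; first by exists 0, 0; ring.
  - by move=> _ _ [s [t ->]] [s' [t' ->]]; exists (s + s'), (t + t'); ring.
  - by move=> c _ [s [t ->]]; exists (c * s), (c * t); ring.
have [a' _ Ea] : principal_ideal g a by rewrite -Ig; exists 1, 0; ring.
have [b' _ Eb] : principal_ideal g b by rewrite -Ig; exists 0, 1; ring.
have [s [t Eg]] : I g by rewrite Ig; apply: principal_ideal_id.
have g0 : g != 0 by apply: contraNneq a0 => g0; rewrite -Ea g0 mulr0.
exists g, a', b', s, t; split=> //; apply: (mulIf g0).
rewrite mul1r; transitivity (s * (a' * g) + t * (b' * g)); first by ring.
by rewrite Ea Eb.
Qed.

(** All entries but the first are merged into one by induction, and this one is
    then merged into the first by the matrix W built from the Bezout
    coefficients. *)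
Lemma pid_column_reduction n (v : 'cV[A]_(1 + n)) :
  exists2 U : 'M[A]_(1 + n), U \in unitmx &
    exists d, U *m v = col_mx d%:M 0.
Proof.
elim: n v => [|n IHn] v.
  exists 1%:M; first exact: unitmx1.
  exists (usubmx v 0 0); rewrite mul1mx -[LHS]vsubmxK -mx11_scalar.
  by congr col_mx; apply/matrixP=> -[].
rewrite -[n.+1]/(1 + n)%N in v *; have [U' uU' [d' Ud']] := IHn (dsubmx v).
have [g [a' [b' [s [t [Ea Eb st1]]]]]] := pid_bezout (usubmx v 0 0) d'.
pose W : 'M[A]_(1 + (1 + n)) :=
  block_mx s%:M (row_mx t%:M 0) (col_mx (- b')%:M 0) (block_mx a'%:M 0 0 1%:M).
pose W' : 'M[A]_(1 + (1 + n)) :=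
  block_mx a'%:M (row_mx (- t)%:M 0) (col_mx b'%:M 0) (block_mx s%:M 0 0 1%:M).
have WW' : W *m W' = 1%:M.
  rewrite mulmx_block mul_row_block mul_row_col mul_block_col mul_col_row.
  rewrite mulmx_block mul_mx_row mul_col_mx.
  rewrite !(mul0mx, mulmx0, mul1mx, add0r, addr0) -!scalar_mxM.
  rewrite add_row_mx add_col_mx add_block_mx -!raddfD.
  rewrite !(add0r, addr0).
  have -> : s * - t + t * s = 0 by ring.
  have -> : - b' * a' + a' * b' = 0 by ring.
  have -> : - b' * - t + a' * s = 1 by rewrite -st1; ring.
  rewrite st1 !raddf0 row_mx0 col_mx0 /=.
  by rewrite -!scalar_mx_block.
exists (W *m block_mx 1%:M 0 0 U').
  rewrite unitmx_mul; apply/andP; split; first by case/mulmx1_unit: WW'.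
  by rewrite unitmxE det_ublock det1 mul1r -unitmxE.
exists g; rewrite -mulmxA -[v]vsubmxK mul_block_col !mul0mx addr0 add0r mul1mx.
rewrite Ud' mul_block_col mul_row_col.
rewrite mul_col_mx mul_block_col.
rewrite !(mul0mx, mulmx0, add0r, addr0).
rewrite [usubmx v]mx11_scalar Ea Eb -!scalar_mxM add_col_mx -!raddfD.
have -> : s * (a' * g) + t * (b' * g) = g by rewrite -[RHS]mul1r -st1; ring.
have -> : - b' * (a' * g) + a' * (b' * g) = 0 by ring.
by rewrite !raddf0 addr0 col_mx0.
Qed.

Hypothesis finA : finite_quotients A.

(** The lattice spanned by the rows of M has index at most the norm of det M.
    An invertible row operation changes neither the lattice nor the norm of the
    determinant, so by [pid_column_reduction] the first column may be taken to
    be (d, 0).  A vector is then reduced modulo d in its first coordinate by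
    subtracting a multiple of the first row, and in the other coordinates by
    induction. *)
Lemma row_lattice_covering n (M : 'M[A]_n) : \det M != 0 ->
  exists (T : finType) (r : T -> 'rV[A]_n),
    covering [set a *m M | a in [set: 'rV[A]_n]] r /\ #|T| = norm (\det M).
Proof.
elim: n M => [|n IHn] M M0.
  exists 'I_1, (fun=> 0); split.
    by move=> x; exists 0, 0; rewrite // [LHS]thinmx0 [RHS]thinmx0.
  rewrite card_ord det_mx00 normE ?oner_eq0 //; apply/eqP.
  have idA := principal_idealP (1 : A).
  rewrite eqn_leq ideal_norm_gt0 //=; last first.
    by apply: finA; apply: nonzero_principal_ideal; rewrite oner_eq0.
  rewrite -[leqRHS](card_ord 1) (@covering_geq _ _ _ (fun=> 0) idA) // => x.
  by exists 0, x; rewrite // mulr1 subr0.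
rewrite -[n.+1]/(1 + n)%N in M M0 *.
have [U uU [d Ud]] := pid_column_reduction (lsubmx M).
pose u := usubmx (rsubmx (U *m M)); pose M' := dsubmx (rsubmx (U *m M)).
have UM : U *m M = block_mx d%:M u 0 M'.
  by rewrite -[LHS]hsubmxK -[rsubmx _]vsubmxK -mulmx_lsub Ud block_mxEh.
have detUM : \det U * \det M = d * \det M'.
  by rewrite -det_mulmx UM det_ublock det_scalar1.
have dM'0 : d * \det M' != 0.
  rewrite -detUM mulf_neq0 //.
  by apply: contraTneq uU; rewrite unitmxE => ->; rewrite unitr0.
have [d0 M'0] : d != 0 /\ \det M' != 0.
  by apply/andP; rewrite -negb_or -mulf_eq0.
have [T' [r' [cr' cardT']]] := IHn _ M'0.
have [r [cr _]] := transversal_exists (principal_idealP d)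
                     (finA (nonzero_principal_ideal d0)).
exists ('I_(ideal_norm (principal_ideal d)) * T')%type,
  (fun ij => row_mx (r ij.1)%:M (r' ij.2)); split; last first.
  rewrite card_prod card_ord cardT' -normE // -normM // -detUM.
  by rewrite norm_mul_unit.
move=> x; have [i [a _ ad]] := cr (lsubmx x 0 0).
have [j [w _ wM']] := cr' (rsubmx x - a *: u).
exists (i, j), (row_mx a%:M w *m U) => //.
rewrite -mulmxA UM mul_row_block mulmx0 addr0 wM' -[x in RHS]hsubmxK.
rewrite opp_row_mx add_row_mx mul_scalar_mx scale_scalar_mx ad; congr row_mx.
  by rewrite [lsubmx x in RHS]mx11_scalar raddfB.
by rewrite mul_scalar_mx addrC addrAC subrK.
Qed.

End PrincipalIdealDomain.

(** * Growth of the norm under sums and determinants *)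

Section NormGrowth.

Variables (A : idomainType) (C : nat).
Hypothesis finA : finite_quotients A.
Hypothesis C_gt0 : (0 < C)%N.
Hypothesis normD : forall x y : A, (norm (x + y) <= C * (norm x + norm y))%N.

Lemma norm1 : norm (1 : A) = 1%N.
Proof.
apply/eqP; rewrite -(eqn_pmul2r (norm_gt0 finA (oner_neq0 A))) mul1n.
by rewrite -normM // mulr1.
Qed.

Lemma norm_prod (T : finType) (F : T -> A) :
  norm (\prod_i F i) = (\prod_i norm (F i))%N.
Proof. exact: (big_morph _ (normM finA) norm1). Qed.

Lemma norm_sum_leq (T : finType) (F : T -> A) :
  (norm (\sum_i F i) <= C ^ #|T| * \sum_i norm (F i))%N.
Proof.
have -> : #|T| = size (index_enum T) by rewrite cardT enumT /index_enum unlock.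
elim: (index_enum T) => [|x s IHs]; first by rewrite !big_nil norm0.
rewrite !big_cons /= expnS -mulnA; apply: leq_trans (normD _ _) _.
rewrite leq_pmul2l // mulnDr leq_add // leq_pmull // expn_gt0 C_gt0 //.
Qed.

Lemma norm_det_leq n (M : 'M[A]_n) X : (forall i j, norm (M i j) <= X)%N ->
  (norm (\det M) <= C ^ #|{perm 'I_n}| * (#|{perm 'I_n}| * X ^ n))%N.
Proof.
move=> MX; apply: leq_trans (norm_sum_leq _) _.
rewrite leq_mul2l -sum_nat_const leq_sum ?orbT // => s _.
rewrite norm_mul_unit ?unitrX ?unitrN1 // norm_prod.
rewrite -[n in (X ^ n)%N]card_ord -prod_nat_const.
by apply: leq_prod => i _; apply: MX.
Qed.

End NormGrowth.

(** The minimal m with N < m ^ n works: (m - 1) ^ n <= N and m <= 2 (m - 1). *)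
Lemma expn_root_bound n N : (0 < n)%N -> (0 < N)%N ->
  exists m, [/\ (0 < m)%N, (N < m ^ n)%N & (m ^ n <= 2 ^ n * N)%N].
Proof.
move=> n0 N0; have ex_m : exists m, (N < m ^ n)%N.
  exists N.+1; apply: leq_trans (ltnSn N) _.
  by rewrite -{1}[N.+1]expn1 leq_pexp2l.
case: (ex_minnP ex_m) => m Nm min_m; exists m.
have m1 : (1 < m)%N.
  by rewrite ltnNge; apply: contraL Nm; case: m {min_m} => [|[|]] //= _;
     rewrite ?exp0n ?exp1n // -leqNgt.
split=> //; first exact: ltnW.
have pm : (m.-1 ^ n <= N)%N.
  rewrite leqNgt; apply/negP => /min_m.
  by case: m m1 {Nm min_m} => // m _; rewrite ltnn.
apply: leq_trans (leq_mul (leqnn _) pm); rewrite -expnMn leq_exp2r //.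
by case: m m1 {Nm min_m pm} => [|[|m]] // _;
   rewrite /= mul2n -addnn !addSn ltnS addnS ltnS leq_addr.
Qed.

Lemma injection_of_card_le (T : Type) (S : set T) m : (`I_m #<= S)%card ->
  exists2 f : 'I_m -> T, injective f & forall i, S (f i).
Proof.
move=> /card_leP[g].
pose el (i : 'I_m) : `I_m := SigSub (mem_set (ltn_ord i : `I_m i)).
exists (fun i => val (g (el i))) => [i j|i]; last first.
  exact: set_mem (valP (g (el i))).
move=> /val_inj gij; suff /(congr1 val) : el i = el j by exact: ord_inj.
by apply: (@inj _ _ _ g) gij; rewrite in_setT.
Qed.

(** * Extensions that are finitely generated and free as modules *)

Section FreeExtension.

Variables (A B : idomainType) (phi : {rmorphism A -> B}).
Variables (n : nat) (e : 'I_n -> B).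
Hypothesis basis_e :
  forall b : B, exists! c : 'rV[A]_n, b = \sum_(i < n) phi (c 0 i) * e i.

Definition lincomb (a : 'rV[A]_n) : B := \sum_(i < n) phi (a 0 i) * e i.

Lemma lincomb_inj : injective lincomb.
Proof.
move=> a a' aa'; have [c [_ c_uniq]] := basis_e (lincomb a).
by rewrite -(c_uniq a) // -(c_uniq a').
Qed.

Lemma lincombD a a' : lincomb (a + a') = lincomb a + lincomb a'.
Proof.
by rewrite -big_split; apply: eq_bigr => i _; rewrite mxE rmorphD mulrDl.
Qed.

Lemma lincombZ c a : lincomb (c *: a) = phi c * lincomb a.
Proof.
by rewrite mulr_sumr; apply: eq_bigr => i _; rewrite mxE rmorphM mulrA.
Qed.

Lemma lincomb0 : lincomb 0 = 0.
Proof. by rewrite -(scale0r 0) lincombZ rmorph0 mul0r. Qed.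

Lemma lincombB a a' : lincomb (a - a') = lincomb a - lincomb a'.
Proof. by rewrite -scaleN1r lincombD lincombZ rmorphN1 mulN1r. Qed.

Lemma lincomb_sum (T : finType) (F : T -> 'rV[A]_n) :
  lincomb (\sum_i F i) = \sum_i lincomb (F i).
Proof. exact: (big_morph _ lincombD lincomb0). Qed.

Lemma lincomb_surj b : exists a, lincomb a = b.
Proof. by have [a [-> _]] := basis_e b; exists a. Qed.

Lemma basis_size_gt0 : (0 < n)%N.
Proof.
rewrite lt0n; apply/eqP => n0; have [a] := lincomb_surj 1.
move=> /esym; rewrite /lincomb big1 => [|i _].
  by move/eqP; rewrite oner_eq0.
by have := ltn_ord i; rewrite {2}n0.
Qed.

Lemma lincomb_neq0 a : (lincomb a != 0) = (a != 0).
Proof. by rewrite -lincomb0 (inj_eq lincomb_inj). Qed.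

Variable C : nat.
Hypothesis pidA : principal_ideal_domain A.
Hypothesis finA : finite_quotients A.
Hypothesis C_gt0 : (0 < C)%N.
Hypothesis normD : forall x y : A, (norm (x + y) <= C * (norm x + norm y))%N.

(** A kernel vector of the matrix of multiplication by alpha would be a zero
    divisor; so det M is nonzero, and [lincomb] carries representatives modulo
    the row lattice of M to representatives modulo alpha. *)
Lemma mulmx_lincomb_covering alpha (M : 'M[A]_n) :
  alpha != 0 -> (forall a, lincomb (a *m M) = alpha * lincomb a) ->
  exists (T : finType) (r : T -> B),
    covering (principal_ideal alpha) r /\ #|T| = norm (\det M).
Proof.
move=> alpha0 MP.
have M0 : \det M != 0.
  apply/det0P=> -[a a0 /(congr1 lincomb)/eqP].
  by rewrite MP lincomb0; apply/negP; rewrite mulf_neq0 ?lincomb_neq0.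
have [T [r [cr cardT]]] := row_lattice_covering pidA finA M0.
exists T, (lincomb \o r); split=> // b.
have [x <-] := lincomb_surj b; have [i [a _ aM]] := cr x.
exists i, (lincomb a) => //.
by rewrite mulrC -MP aM lincombB.
Qed.

(** The entries of the matrix of multiplication by an element are linear forms
    in its coordinates, whose coefficients are the structure constants gamma of
    the algebra; K depends on these and on C only. *)
Lemma norm_lincomb_leq : exists K : nat, forall (x : 'rV[A]_n) X,
  x != 0 -> (forall i, norm (x 0%R i) <= X)%N ->
  finite_set (ideal_quotient (principal_ideal (lincomb x))) /\
  (norm (lincomb x) <= K * X ^ n)%N.
Proof.
have [coord coordP] := choice lincomb_surj.
pose gamma i k := coord (e k * e i).
pose G := (\sum_i \sum_j \sum_k norm (gamma i k 0%R j))%N.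
exists (C ^ #|{perm 'I_n}| * (#|{perm 'I_n}| * (C ^ n * G) ^ n))%N => x X x0 xX.
pose M := \matrix_(i < n) \sum_k x 0 k *: gamma i k.
have MP a : lincomb (a *m M) = lincomb x * lincomb a.
  rewrite mulmx_sum_row lincomb_sum mulr_sumr; apply: eq_bigr => i _.
  rewrite lincombZ rowK lincomb_sum mulrCA mulr_suml; congr (_ * _).
  by apply: eq_bigr => k _; rewrite lincombZ coordP mulrA.
have lx0 : lincomb x != 0 by rewrite lincomb_neq0.
have [T [r [cr cardT]]] := mulmx_lincomb_covering lx0 MP.
have idx := principal_idealP (lincomb x).
split; first exact: covering_finite cr.
rewrite [in X in (X <= _)%N]normE //; apply: leq_trans (covering_geq idx cr) _.
rewrite cardT -!mulnA -expnMn !mulnA -mulnA.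
apply: norm_det_leq => // i j; rewrite mxE summxE.
apply: leq_trans (norm_sum_leq C_gt0 normD _) _.
rewrite card_ord -mulnA leq_mul2l; apply/orP; right.
apply: (@leq_trans (\sum_k norm (gamma i k 0%R j) * X)%N).
  by apply: leq_sum => k _; rewrite mxE normM // mulnC leq_mul2l xX orbT.
rewrite -big_distrl leq_mul2r; apply/orP; right.
rewrite [leqRHS](bigD1 i) //=; apply: leq_trans _ (leq_addr _ _).
by rewrite [leqRHS](bigD1 j) //= leq_addr.
Qed.

Lemma free_extension_finite_quotients : finite_quotients B.
Proof.
apply: finite_quotients_of_principal => b b0.
have [x xb] := lincomb_surj b; have [K KP] := norm_lincomb_leq.
have x0 : x != 0 by rewrite -lincomb_neq0 xb.
have [|+ _] := KP x (\max_i norm (x 0%R i))%N x0; last by rewrite xb.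
by move=> i; apply: (leq_bigmax i).
Qed.

Hypothesis finB : finite_quotients B.
Variable c : nat.
Hypothesis many : forall m, (0 < m)%N ->
  (`I_m #<= [set x : A | (norm x <= c * m)%N])%card.

(** Pigeonhole principle on the vectors whose coordinates lie among m given
    elements of norm at most c * m, where m ^ n just exceeds the index of I. *)
Lemma small_element_of_ideal : exists K : nat, (0 < K)%N /\
  forall I : set B, nonzero_ideal I -> exists alpha,
    [/\ I alpha, alpha != 0 & (norm alpha <= K * ideal_norm I)%N].
Proof.
have [K KP] := norm_lincomb_leq.
(* A difference of two elements of norm at most c * m has norm at most
   C * (c + c) * m, and m ^ n <= 2 ^ n * N; the successor only serves to make
   the constant positive. *)
exists (K * (C * (c + c)) ^ n * 2 ^ n).+1; split=> // I nzI.
have [idI _] := nzI; have N_gt0 := ideal_norm_gt0 idI (finB nzI).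
have [m [m_gt0 Nm mN]] := expn_root_bound basis_size_gt0 N_gt0.
have [f f_inj fP] := injection_of_card_le (many m_gt0).
pose v (s : {ffun 'I_n -> 'I_m}) := \row_j f (s j).
have [s [t [st Ist]]] :
    exists s t, s <> t /\ I (lincomb (v s) - lincomb (v t)).
  apply: not_packingP => /(packing_leq idI (finB nzI)).
  by rewrite card_ffun !card_ord leqNgt Nm.
have vst0 : v s - v t != 0.
  rewrite subr_eq0; apply/eqP => /rowP vst; apply: st; apply/ffunP => i.
  by apply: f_inj; have := vst i; rewrite !mxE.
exists (lincomb (v s - v t)); rewrite lincomb_neq0 lincombB; split=> //.
have [|_] := KP (v s - v t) (C * (c + c) * m)%N vst0.
  move=> i; rewrite !mxE -mulnA mulnDl; apply: leq_trans (normD _ _) _.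
  by rewrite leq_mul2l norm_opp leq_add ?orbT // fP.
rewrite lincombB => /leq_trans; apply.
rewrite expnMn mulnA; apply: leq_trans (leq_mul (leqnn _) mN) _.
by rewrite mulnA leq_mul2r leqnSn orbT.
Qed.

End FreeExtension.

(** * Finiteness of the class group from small elements *)

Section ClassGroup.

Variable R : idomainType.
Implicit Types I J : set R.

Lemma ideal_equiv_sym I J : ideal_equiv I J -> ideal_equiv J I.
Proof. by case=> a [b [a0 b0 E]]; exists b, a. Qed.

Lemma scale_idealM a b I :
  scale_ideal (a * b) I = scale_ideal a (scale_ideal b I).
Proof.
apply/seteqP; split=> [_ [x Ix <-]|_ [_ [x Ix <-] <-]].
  by exists (b * x); [exists x | rewrite mulrA].
by exists x; rewrite ?mulrA.
Qed.

Lemma ideal_equiv_trans I J K :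
  ideal_equiv I J -> ideal_equiv J K -> ideal_equiv I K.
Proof.
case=> a [b [a0 b0 aIbJ]] [c [d [c0 d0 cJdK]]].
exists (c * a), (b * d); split; rewrite ?mulf_neq0 //.
by rewrite !scale_idealM aIbJ -cJdK -!scale_idealM mulrC.
Qed.

Lemma scale_idealP b I : is_ideal I -> is_ideal (scale_ideal b I).
Proof.
case=> I0 ID IM; split; first by exists 0; rewrite ?mulr0.
- move=> _ _ [x Ix <-] [y Iy <-]; exists (x + y); first exact: ID.
  by rewrite mulrDr.
- by move=> a _ [x Ix <-]; exists (a * x); [apply: IM | rewrite mulrCA].
Qed.

Hypothesis finR : finite_quotients R.

(** The index of alpha R in I is N(alpha) / N(I), at most C: adding a packing of
    size C + 1 inside I to a transversal of R modulo I would give (C + 1) N(I)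
    elements that are pairwise incongruent modulo alpha. *)
Lemma congruent_pair_of_norm_leq C I alpha (z : 'I_C.+1 -> R) :
  is_ideal I -> I alpha -> alpha != 0 -> (norm alpha <= C * ideal_norm I)%N ->
  (forall i, I (z i)) ->
  exists i j, i <> j /\ principal_ideal alpha (z i - z j).
Proof.
move=> idI Ia a0 le_norm Iz; apply: not_packingP => pz.
have ida := principal_idealP alpha; have [_ _ IM] := idI.
have finI : finite_set (ideal_quotient I).
  by apply: finR; split=> // I0; move: Ia a0; rewrite I0 => ->; rewrite eqxx.
have [y [_ py]] := transversal_exists idI finI.
pose w (ij : 'I_(ideal_norm I) * 'I_C.+1) := y ij.1 + z ij.2.
have fina := finR (nonzero_principal_ideal a0).
suff /(packing_leq ida fina) : packing (principal_ideal alpha) w.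
  rewrite -normE // card_prod !card_ord => /leq_trans/(_ le_norm).
  by rewrite mulnC leq_pmul2r ?ltnn // ideal_norm_gt0.
move=> [i j] [i' j']; rewrite /w /= => aw.
have ii' : i = i'.
  apply: py.
  have -> : y i - y i' = (y i + z j - (y i' + z j')) - (z j - z j') by ring.
  by case: aw => c _ <-; apply: ideal_sub (IM _ _ Ia) (ideal_sub _ _ _).
rewrite -{i'}ii' in aw *; congr pair; apply: pz.
by have <- : y i + z j - (y i + z j') = z j - z j' by ring.
Qed.

(** The first C + 1 values of f give a nonzero b, independent of I, that
    multiplies every I into the ideal generated by its small element alpha.
    Every class then has a member containing b, namely alpha^-1 b I. *)
Lemma finite_ideal_class_group (f : nat -> R) C : injective f ->
  (forall I, nonzero_ideal I -> exists alpha,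
     [/\ I alpha, alpha != 0 & (norm alpha <= C * ideal_norm I)%N]) ->
  finite_set (ideal_class_group R).
Proof.
move=> f_inj small.
pose b := \prod_(ij : 'I_C.+1 * 'I_C.+1 | ij.1 != ij.2) (f ij.1 - f ij.2).
have b0 : b != 0.
  apply/prodf_neq0=> -[i j] /= ij; rewrite subr_eq0.
  by apply: contraNneq ij => /f_inj/val_inj->.
have finJ := finite_ideals_containing (finR (nonzero_principal_ideal b0)).
pose cls I := [set J | nonzero_ideal J /\ ideal_equiv I J].
apply: (sub_finite_set _ (finite_image cls finJ)) => _ [I nzI <-].
have [idI _] := nzI; have [_ _ IM] := idI.
have [alpha [Ia a0 le_norm]] := small I nzI.
have bI x : I x -> principal_ideal alpha (b * x).
  (* Two of the elements f i * x of I are congruent modulo alpha, and f i - f j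
     is one of the factors of b. *)
  move=> Ix; pose z (i : 'I_C.+1) := f i * x.
  have [i [j [/eqP ij [c _ ca]]]] :=
    congruent_pair_of_norm_leq (z := z) idI Ia a0 le_norm (fun i => IM _ _ Ix).
  rewrite /b (bigD1 (i, j)) //= mulrAC mulrBl -/(z i) -/(z j) -ca.
  by rewrite mulrC mulrA; eexists.
(* J is the fractional ideal alpha^-1 b I, which is integral by bI. *)
pose J := [set y | scale_ideal b I (alpha * y)].
have [bI0 bID bIM] := scale_idealP b idI.
have idJ : is_ideal J.
  split; rewrite /J /=; first by rewrite mulr0.
  - by move=> x y; rewrite mulrDr; apply: bID.
  - by move=> a x; rewrite mulrCA; apply: bIM.
have Jb : J b by exists alpha; rewrite // mulrC.
have IJ : ideal_equiv I J.
  exists b, alpha; split=> //; apply/seteqP; split=> [x|_ [y Jy <-]//].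
  move=> bIx; have [z Iz zx] := bIx; have [c _ ca] := bI z Iz.
  by exists c; [rewrite /J /= mulrC ca zx | rewrite mulrC ca zx].
exists J; first by [].
apply/seteqP; split=> K [nzK]; split=> //.
  exact: ideal_equiv_trans IJ _.
exact: ideal_equiv_trans (ideal_equiv_sym IJ) _.
Qed.

End ClassGroup.

Lemma expr_inj (A : idomainType) (x : A) :
  x != 0 -> x \isn't a GRing.unit -> injective (fun i => x ^+ i).
Proof.
move=> x0 xU; suff lt_neq i j : (i < j)%N -> x ^+ i != x ^+ j.
  move=> i j /= /eqP xij; apply/eqP; move: xij; apply: contraLR.
  by case: ltngtP => // /lt_neq //; rewrite eq_sym.
move=> ltij; apply: contraNneq xU => xij.
rewrite -(@unitrX_pos _ x (j - i)) ?subn_gt0 //.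
suff -> : x ^+ (j - i) = 1 by rewrite unitr1.
by apply: (mulfI (expf_neq0 i x0)); rewrite -exprD subnKC 1?ltnW // -xij mulr1.
Qed.

Theorem theorem7 (A B : idomainType) (phi : {rmorphism A -> B})
    (hA : basic_PID A) (hB : class_G phi) :
  (exists C : nat, (0 < C)%N /\
     forall I : set B, nonzero_ideal I ->
       exists alpha : B,
         [/\ I alpha, alpha != 0 & (norm alpha <= C * ideal_norm I)%N])
  /\ finite_set (ideal_class_group B).
Proof.
case: hA => pidA [p [p0 pU]] finA [c [c0 many]] [C [C0 normD]].
case: hB => _ [n [e basis_e]].
have finB := free_extension_finite_quotients basis_e pidA finA C0 normD.
have [K [K0 small]] :=
  small_element_of_ideal basis_e pidA finA C0 normD finB many.
split; first by exists K.
(* The powers of a nonunit p of A are distinct; const_mx makes of them distinct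
   elements of B. *)
pose f i := lincomb phi e (const_mx (p ^+ i)).
apply: (finite_ideal_class_group finB (f := f)) small.
move=> i j /(lincomb_inj basis_e)/rowP/(_ (Ordinal (basis_size_gt0 basis_e))).
by rewrite !mxE; apply: expr_inj.
Qed.
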